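(* Let $m,n\ge 1$ and set $d:=\min\{m,n\}$. For all $A_1,\dots,A_m\in\mathbb{M}_n$, $$\Bigl\|\sum_{k=1}^m A_k\Bigr\|_2\ \le\ \sqrt{\frac{1+\sqrt{d}}{2}}\;\Bigl\|\sum_{k=1}^m |A_k|\Bigr\|_2.$$ Moreover, the constant $\sqrt{\frac{1+\sqrt{d}}{2}}$ is sharp: if $c$ is a real number such that $\|\sum_{k=1}^m A_k\|_2\le c\,\|\sum_{k=1}^m|A_k|\|_2$ for all $A_1,\dots,A_m\in\mathbb{M}_n$, then $c\ge\sqrt{\frac{1+\sqrt{d}}{2}}$.
   Context: $\mathbb{M}_n$ is the set of $n\times n$ complex matrices, $Z^*$ is the conjugate transpose of $Z$, and $|Z|:=(Z^*Z)^{1/2}$. $\|X\|_2:=(\operatorname{Tr}(X^*X))^{1/2}$ is the Frobenius (Schatten $2$-) norm. *)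

(* Defs.v *)
From mathcomp Require Import all_boot all_order all_algebra.
From mathcomp Require Import complex reals.

Set Implicit Arguments.
Unset Strict Implicit.
Unset Printing Implicit Defensive.

Import Order.TTheory GRing.Theory Num.Theory.
Local Open Scope ring_scope.
Local Open Scope sesquilinear_scope.

(* The principal square root of a positive semidefinite matrix, by functional
   calculus: if P = U^* diag(l) U with U unitary (spectralmx, spectral_diag),
   its square root is U^* diag(sqrt l) U.  The value is meaningless when P is
   not positive semidefinite. *)
Definition sqrtmx (C : numClosedFieldType) (n : nat) (P : 'M[C]_n) : 'M[C]_n :=
  invmx (spectralmx P) *m diag_mx (map_mx sqrtC (spectral_diag P))
    *m spectralmx P.

Definition absmx (C : numClosedFieldType) (n : nat) (Z : 'M[C]_n) : 'M[C]_n :=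
  sqrtmx (Z ^t* *m Z).

(* The trace of X^* X is a nonnegative real (frobeniusE below), so taking its
   real part only changes its type from R[i] to R. *)
Definition frobenius (R : realType) (n : nat) (X : 'M[R[i]]_n) : R :=
  Num.sqrt (complex.Re (\tr (X ^t* *m X))).

Definition psdmx (C : numClosedFieldType) (n : nat) (P : 'M[C]_n) : Prop :=
  P ^t* = P /\ forall v : 'cV[C]_n, 0 <= (v ^t* *m P *m v) 0 0.

Section SquareRoot.
Variables (C : numClosedFieldType) (n : nat).
Implicit Types P B Z : 'M[C]_n.

Lemma trmxC_mul m p q (A : 'M[C]_(m, p)) (B : 'M[C]_(p, q)) :
  (A *m B) ^t* = B ^t* *m A ^t*.
Proof. by rewrite trmx_mul map_mxM. Qed.

Lemma trmxC_mul_self_ge0 m p (A : 'M[C]_(m, p)) i : 0 <= (A ^t* *m A) i i.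
Proof.
rewrite mxE sumr_ge0 // => j _.
by rewrite !mxE mulrC -normCK exprn_ge0.
Qed.

Lemma psd_spectral P : psdmx P ->
  P = (spectralmx P) ^t* *m diag_mx (spectral_diag P) *m spectralmx P
  /\ forall i, 0 <= spectral_diag P 0 i.
Proof.
move=> [herm pos].
have Un := spectral_unitarymx P.
have nP : P \is normalmx by apply/normalmxP; rewrite herm.
have E := orthomx_spectralP nP.
rewrite invmx_unitary // in E.
split=> // i.
have := pos ((spectralmx P) ^t* *m delta_mx i 0).
rewrite {2}E trmxC_mul trmxCK !mulmxA.
rewrite -[in X in X *m diag_mx _]mulmxA (unitarymxP Un) mulmx1.
rewrite -[in X in X *m delta_mx _ _]mulmxA (unitarymxP Un) mulmx1.
rewrite -!mulmxA.
have -> : ((delta_mx i 0 : 'cV[C]_n) ^t*) = delta_mx 0 i.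
  by rewrite trmx_delta map_delta_mx.
by rewrite -rowE -colE !mxE eqxx mulr1n.
Qed.

Lemma psd_unitary_diag (U : 'M[C]_n) (l : 'rV[C]_n) :
  (forall i, 0 <= l 0 i) -> psdmx (U ^t* *m diag_mx l *m U).
Proof.
move=> l0; split.
  rewrite !trmxC_mul trmxCK mulmxA; congr (_ *m _ *m _).
  rewrite tr_diag_mx map_diag_mx; congr diag_mx; apply/rowP=> i; rewrite mxE.
  exact/CrealP/ger0_real.
move=> v.
have -> : v ^t* *m (U ^t* *m diag_mx l *m U) *m v
    = (U *m v) ^t* *m (diag_mx l *m (U *m v)) by rewrite trmxC_mul !mulmxA.
rewrite mul_diag_mx mxE sumr_ge0 // => j _; move: (U *m v) => w; rewrite !mxE.
by rewrite mulrCA mulr_ge0 // mulrC -normCK exprn_ge0.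
Qed.

Lemma sqrtmxE P : sqrtmx P = (spectralmx P) ^t*
  *m diag_mx (map_mx sqrtC (spectral_diag P)) *m spectralmx P.
Proof. by rewrite /sqrtmx invmx_unitary ?spectral_unitarymx. Qed.

Lemma sqrtmx_psd P : psdmx P -> psdmx (sqrtmx P).
Proof.
move=> /psd_spectral[_ l0]; rewrite sqrtmxE; apply: psd_unitary_diag => i.
by rewrite mxE sqrtC_ge0.
Qed.

Lemma sqrtmxK P : psdmx P -> sqrtmx P *m sqrtmx P = P.
Proof.
move=> /psd_spectral[E _]; rewrite sqrtmxE !mulmxA.
rewrite -[in X in X *m diag_mx _ *m _]mulmxA.
rewrite (unitarymxP (spectral_unitarymx P)) mulmx1.
rewrite -[in X in X *m spectralmx _]mulmxA mulmx_diag [RHS]E.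
congr (_ *m diag_mx _ *m _); apply/rowP => i.
by rewrite !mxE -expr2 sqrtCK.
Qed.

Lemma sqrtmx_uniq P B : psdmx P -> psdmx B -> B *m B = P -> B = sqrtmx P.
Proof.
move=> psdP psdB BB; rewrite sqrtmxE.
have [EP l0] := psd_spectral psdP; have [EB d0] := psd_spectral psdB.
have UB := unitarymxP (spectral_unitarymx B).
have UP := unitarymxP (spectral_unitarymx P).
have UB' := mulmx1C UB; have UP' := mulmx1C UP.
move: (spectralmx P) (spectral_diag P) EP l0 UP UP' => V l EP l0 UP UP'.
move: (spectralmx B) (spectral_diag B) EB d0 UB UB' => U d EB d0 UB UB'.
pose W := V *m U ^t*.
have EW : diag_mx l *m W = W *m diag_mx (\row_i (d 0 i ^+ 2)).
  have -> : diag_mx (\row_i (d 0 i ^+ 2)) = U *m B *m B *m U ^t*.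
    rewrite EB !mulmxA UB mul1mx -(mulmxA _ U) UB mulmx1.
    rewrite -(mulmxA _ U) UB mulmx1 mulmx_diag.
    by congr diag_mx; apply/rowP=> i; rewrite !mxE expr2.
  rewrite /W -!mulmxA (mulmxA B B) BB {1}EP !mulmxA.
  rewrite -(mulmxA V _ U) UB' mulmx1.
  by rewrite UP mul1mx.
have {}EW : diag_mx (map_mx sqrtC l) *m W = W *m diag_mx d.
  move: W EW => W EW; apply/matrixP => i j; move/matrixP/(_ i j): EW.
  rewrite !mul_diag_mx !mul_mx_diag !mxE mulrC.
  have [->|W0 /(mulfI W0) ->] := eqVneq (W i j) 0; first by rewrite !mul0r mulr0.
  by rewrite sqrCK // mulrC.
have EV : V = W *m U by rewrite /W -mulmxA UB' mulmx1.
rewrite [in X in _ *m X]EV mulmxA -(mulmxA _ _ W) EW EB mulmxA.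
by rewrite /W !mulmxA UP' mul1mx.
Qed.

Lemma gram_psd Z : psdmx (Z ^t* *m Z).
Proof.
split=> [|v]; first by rewrite trmxC_mul trmxCK.
by rewrite mulmxA -trmxC_mul -mulmxA trmxC_mul_self_ge0.
Qed.

Lemma absmxP Z B :
  B = absmx Z <-> psdmx B /\ B *m B = Z ^t* *m Z.
Proof.
split=> [->|[psdB BB]]; last exact: sqrtmx_uniq (gram_psd Z) psdB BB.
by split; [exact: sqrtmx_psd (gram_psd Z) | exact: sqrtmxK (gram_psd Z)].
Qed.

End SquareRoot.

Lemma frobeniusE (R : realType) (n : nat) (X : 'M[R[i]]_n) :
  0 <= \tr (X ^t* *m X) /\
  (real_complex R (frobenius X)) = sqrtC (\tr (X ^t* *m X)).
Proof.
have tr0 : 0 <= \tr (X ^t* *m X).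
  by rewrite sumr_ge0 // => i _; exact: trmxC_mul_self_ge0.
split=> //; rewrite /frobenius; move: (\tr _) tr0 => [a b].
rewrite lecE /= => /andP[/eqP -> a0].
apply/eqP; rewrite -(@eqrXn2 _ 2) ?sqrtC_ge0 ?lecR ?sqrtr_ge0 //.
  by rewrite sqrtCK -rmorphXn /= sqr_sqrtr.
Qed.

(* Main.v *)
Require Import Defs.
From mathcomp Require Import all_boot all_order all_algebra.
From mathcomp Require Import complex reals ring.
Set Implicit Arguments.
Unset Strict Implicit.
Unset Printing Implicit Defensive.
Import Order.TTheory GRing.Theory Num.Theory.
Local Open Scope ring_scope.
Local Open Scope sesquilinear_scope.

(** Put X = sum A_k, P = sum |A_k| and r = sqrt d; the claim is that
    2 ||X||^2 <= (1 + r) ||P||^2, with an optimal constant.  Both bounds rest on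
    the splitting A = K |A|^(1/2) with K^* K = |A| (half_polar), which does the
    work of a polar decomposition.

    Bound with d = m (sum_le_card).  For two matrices A = K S and B = L T split
    in this way, expanding ||t S T - K^* L||^2 >= 0 bounds the cross term
    2 t Re tr(A^* B) by t^2 tr(|A| |B|) + ||K^* L||^2.  The last term is the
    inner product of K K^* and L L^*, so it is at most (||A||^2 + ||B||^2) / 2
    because K K^* has the same norm as A (cross_trace_le).  Take t = 1 + r and
    sum over all pairs (j, k).  For j = k the two sides of cross_trace_le differ
    by exactly 2 r^2 ||A_j||^2; subtracting this there, with r^2 = m, cancels
    all the squared norms of the A_j and leaves the result.

    Bound with d = n (sum_le_dim).  Stacking the splittings gives
    ||X||^2 <= lambda tr P with lambda the largest eigenvalue of P
    (sqfrob_sum_le_peak).  It remains to see that n numbers 0 <= l_i <= lambda,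
    one of them equal to lambda, satisfy
    2 lambda (sum l_i) <= (1 + sqrt n) (sum l_i^2), which is again a sum of
    squares corrected by its defect at one index (peak_sum_le).

    Sharpness (exists_extremal).  Equality in the argument for m asks for rank
    one matrices A_k = u v_k^* with equiangular v_k of common squared norm N and
    inner products N / (1 + r).  The vectors v_k = a e_k + (1, ..., 1) in
    dimension d do this for a suitable a; they are padded with zero
    coordinates and zero vectors when n > d or m > d. *)

(** * The squared Frobenius norm *)

Section SquaredNorms.
Variable C : numClosedFieldType.

(** The square of the Frobenius norm, kept in the algebraically closed field:
    traces and cross terms then need no real parts, the order of the field
    carrying the information that they are real. *)
Definition sqfrob p q (X : 'M[C]_(p, q)) : C := \tr (X ^t* *m X).

Lemma sqfrob_ge0 p q (X : 'M[C]_(p, q)) : 0 <= sqfrob X.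
Proof. by apply: sumr_ge0 => i _; exact: trmxC_mul_self_ge0. Qed.

Lemma trmxCB p q (X Y : 'M[C]_(p, q)) : (X - Y) ^t* = X ^t* - Y ^t*.
Proof. by rewrite linearB /= map_mxB. Qed.

Lemma trmxC_sum p q (I : finType) (X : I -> 'M[C]_(p, q)) :
  (\sum_i X i) ^t* = \sum_i (X i) ^t*.
Proof. by rewrite linear_sum /= map_mx_sum. Qed.

Lemma trmxCZ p q (a : C) (X : 'M[C]_(p, q)) : (a *: X) ^t* = a^* *: X ^t*.
Proof. by rewrite linearZ /= map_mxZ. Qed.

Lemma sqfrobZB p q (t : C) (X Y : 'M[C]_(p, q)) : t^* = t ->
  sqfrob (t *: X - Y) =
  t ^+ 2 * sqfrob X + sqfrob Y - t * (\tr (X ^t* *m Y) + \tr (Y ^t* *m X)).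
Proof.
move=> tR; rewrite /sqfrob trmxCB trmxCZ tR mulmxBl !mulmxBr.
rewrite -!scalemxAl -!scalemxAr !raddfB /= !mxtraceZ; ring.
Qed.

Lemma sqfrob_sum p q (I : finType) (X : I -> 'M[C]_(p, q)) :
  sqfrob (\sum_i X i) = \sum_i \sum_j \tr ((X i) ^t* *m X j).
Proof.
rewrite /sqfrob trmxC_sum mulmx_suml raddf_sum; apply: eq_bigr => i _ /=.
by rewrite mulmx_sumr raddf_sum.
Qed.

Lemma gram_diag p q (X : 'M[C]_(p, q)) i :
  (X ^t* *m X) i i = \sum_j `|X j i| ^+ 2.
Proof.
by rewrite mxE; apply: eq_bigr => j _; rewrite !mxE mulrC -normCK.
Qed.

(** * Splitting a matrix along the square root of its absolute value *)

(** K is A |A|^(-1/2), with the inverse taken to be 0 on the kernel of |A|; this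
    loses nothing because A vanishes there. *)
Lemma half_polar n (A : 'M[C]_n) :
  exists2 K : 'M[C]_n, K ^t* *m K = absmx A & A = K *m sqrtmx (absmx A).
Proof.
have [psdP PP] := (absmxP A (absmx A)).1 erefl.
have [EP l0] := psd_spectral psdP.
have UV := unitarymxP (spectral_unitarymx (absmx A)).
rewrite sqrtmxE.
move: (absmx A) (spectralmx _) (spectral_diag _) EP l0 UV psdP PP => P V l EP l0 UV
  psdP PP.
have UV' := mulmx1C UV.
(* The columns of B are the images under A of the eigenvectors of |A|; they are
   orthogonal, with the eigenvalues of |A| as norms. *)
pose B := A *m V ^t*.
have BB : B ^t* *m B = diag_mx (\row_i (l 0 i ^+ 2)).
  rewrite /B trmxC_mul trmxCK !mulmxA -(mulmxA V) -PP EP !mulmxA UV mul1mx.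
  rewrite -(mulmxA _ V) UV mulmx1 -(mulmxA _ V) UV mulmx1 mulmx_diag.
  by congr diag_mx; apply/rowP=> i; rewrite !mxE expr2.
have BV : B *m V = A by rewrite /B -mulmxA UV' mulmx1.
clearbody B.
have B0 i j : l 0 i = 0 -> B j i = 0.
  move=> li0; have : \sum_k `|B k i| ^+ 2 = 0.
    by rewrite -gram_diag BB !mxE eqxx mulr1n li0 expr0n.
  move=> /eqP; rewrite psumr_eq0 => [/allP/(_ j)|k _]; last exact: exprn_ge0.
  by rewrite mem_index_enum expf_eq0 normr_eq0 => /(_ isT) /eqP.
pose s : 'rV[C]_n := \row_i (sqrtC (l 0 i))^-1.
have sC : (diag_mx s) ^t* = diag_mx s.
  rewrite tr_diag_mx map_diag_mx; congr diag_mx; apply/rowP=> i; rewrite !mxE.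
  by apply/CrealP/ger0_real; rewrite invr_ge0 sqrtC_ge0.
exists (B *m diag_mx s *m V).
  rewrite !trmxC_mul sC -!mulmxA (mulmxA _ B) BB [RHS]EP -!mulmxA.
  congr (_ *m _); rewrite !mulmxA; congr (_ *m _).
  rewrite !mulmx_diag; congr diag_mx; apply/rowP=> i; rewrite !mxE.
  have [->|li0] := eqVneq (l 0 i) 0; first by rewrite expr0n /= mulr0 mul0r.
  have : sqrtC (l 0 i) != 0 by rewrite sqrtC_eq0.
  move: (sqrtCK (l 0 i)); move: (sqrtC _) => x <- x0; field.
  exact: x0.
rewrite !mulmxA -(mulmxA _ V) UV mulmx1 -(mulmxA B) mulmx_diag.
suff -> : B *m diag_mx (\row_j (s 0 j * (map_mx sqrtC l) 0 j)) = B.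
  by rewrite BV.
rewrite mul_mx_diag; apply/matrixP => j i; rewrite !mxE.
have [/B0->|li0] := eqVneq (l 0 i) 0; first by rewrite mul0r.
by rewrite mulVf ?mulr1 // sqrtC_eq0.
Qed.

Lemma absmx_psd n (A : 'M[C]_n) : psdmx (absmx A).
Proof. by have [] := (absmxP A (absmx A)).1 erefl. Qed.

Lemma absmx_herm n (A : 'M[C]_n) : (absmx A) ^t* = absmx A.
Proof. by have [] := absmx_psd A. Qed.

Lemma absmx_sq n (A : 'M[C]_n) : absmx A *m absmx A = A ^t* *m A.
Proof. by have [_ ->] := (absmxP A (absmx A)).1 erefl. Qed.

(** * The bound by the number of matrices *)

(** With A = K S and B = L T, tr(A^* B) is the inner product of S T and K^* L,
    so the claim comes from the nonnegativity of ||t S T - K^* L||^2 and of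
    ||K K^* - L L^*||^2. *)
Lemma cross_trace_le n (t : C) (A B : 'M[C]_n) : 0 <= t ->
  2 * t * (\tr (A ^t* *m B) + \tr (B ^t* *m A)) <=
  2 * t ^+ 2 * \tr (absmx A *m absmx B) + sqfrob A + sqfrob B.
Proof.
move=> t0; have tR : t^* = t by apply/CrealP/ger0_real.
have [K KK EA] := half_polar A; have [L LL EB] := half_polar B.
have psdA := absmx_psd A; have psdB := absmx_psd B.
have [SC _] := sqrtmx_psd psdA; have SS := sqrtmxK psdA.
have [TC _] := sqrtmx_psd psdB; have TT := sqrtmxK psdB.
have PA := absmx_sq A; have PB := absmx_sq B.
move: (sqrtmx (absmx A)) (sqrtmx (absmx B)) SC SS TC TT EA EB.
move=> S T SC SS TC TT EA EB.
have h1 := sqfrob_ge0 (t *: (S *m T) - K ^t* *m L).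
have h2 := sqfrob_ge0 (1 *: (K *m K ^t*) - L *m L ^t*).
have e1 : sqfrob (S *m T) = \tr (absmx A *m absmx B).
  rewrite /sqfrob trmxC_mul SC TC -(mulmxA T) (mulmxA S) SS mxtrace_mulC.
  by rewrite -mulmxA TT.
have e2 : sqfrob (K ^t* *m L) = \tr (K *m K ^t* *m (L *m L ^t*)).
  by rewrite /sqfrob trmxC_mul trmxCK -mulmxA mxtrace_mulC !mulmxA.
have e3 : \tr ((S *m T) ^t* *m (K ^t* *m L)) = \tr (A ^t* *m B).
  by rewrite EA EB !trmxC_mul SC TC -mulmxA mxtrace_mulC !mulmxA.
have e4 : \tr ((K ^t* *m L) ^t* *m (S *m T)) = \tr (B ^t* *m A).
  rewrite EA EB !trmxC_mul TC trmxCK -(mulmxA T) [RHS]mxtrace_mulC.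
  by rewrite !mulmxA.
have gramE (X : 'M[C]_n) :
  sqfrob (X *m X ^t*) = \tr ((X ^t* *m X) *m (X ^t* *m X)).
  by rewrite /sqfrob trmxC_mul trmxCK -mulmxA mxtrace_mulC !mulmxA.
have e5 : sqfrob (K *m K ^t*) = sqfrob A.
  by rewrite gramE KK PA.
have e6 : sqfrob (L *m L ^t*) = sqfrob B.
  by rewrite gramE LL PB.
have e7 : \tr (L *m L ^t* *m (K *m K ^t*)) = \tr (K *m K ^t* *m (L *m L ^t*)).
  exact: mxtrace_mulC.
move: h1 h2; rewrite (sqfrobZB _ _ tR) sqfrobZB ?conjC1 //.
have [KH LH] : (K *m K ^t*) ^t* = K *m K ^t* /\ (L *m L ^t*) ^t* = L *m L ^t*.
  by rewrite !trmxC_mul !trmxCK.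
rewrite KH LH e1 e2 e3 e4 e5 e6 e7 => h1 h2.
rewrite -subr_ge0; have := addr_ge0 (mulr_ge0 (ler0n _ 2) h1) h2.
by congr (0 <= _); ring.
Qed.

Lemma sum_le_card m n (A : 'I_m -> 'M[C]_n) (r : C) : 0 <= r -> r ^+ 2 = m%:R ->
  2 * sqfrob (\sum_k A k) <= (1 + r) * sqfrob (\sum_k absmx (A k)).
Proof.
move=> r0 rm; have t0 : 0 < 1 + r by rewrite ltr_wpDr.
(* On the diagonal this is an equality; the subtracted term is what makes the
   squared norms of the A_j cancel in the double sum. *)
have pair j k :
  2 * (1 + r) * (\tr ((A j) ^t* *m A k) + \tr ((A k) ^t* *m A j)) <=
   2 * (1 + r) ^+ 2 * \tr (absmx (A j) *m absmx (A k))
   + sqfrob (A j) + sqfrob (A k) - (2 * r ^+ 2 * sqfrob (A j)) *+ (j == k).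
  have [<-|_] := eqVneq j k; last by rewrite subr0 cross_trace_le // ltW.
  rewrite absmx_sq /sqfrob mulr1n le_eqVlt; apply/orP; left; apply/eqP; ring.
have sumS : \sum_j \sum_k
     (2 * (1 + r) * (\tr ((A j) ^t* *m A k) + \tr ((A k) ^t* *m A j)))
   = 4 * (1 + r) * sqfrob (\sum_k A k).
  under eq_bigr do rewrite -mulr_sumr big_split.
  rewrite -mulr_sumr big_split /= -sqfrob_sum exchange_big /= -sqfrob_sum.
  ring.
have sumE : \sum_j \sum_k (2 * (1 + r) ^+ 2 * \tr (absmx (A j) *m absmx (A k))
   + sqfrob (A j) + sqfrob (A k) - (2 * r ^+ 2 * sqfrob (A j)) *+ (j == k))
   = 2 * (1 + r) ^+ 2 * sqfrob (\sum_k absmx (A k)).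
  have row_sum j : \sum_k (2 * (1 + r) ^+ 2 * \tr (absmx (A j) *m absmx (A k))
     + sqfrob (A j) + sqfrob (A k) - (2 * r ^+ 2 * sqfrob (A j)) *+ (j == k))
     = 2 * (1 + r) ^+ 2 * (\sum_k \tr ((absmx (A j)) ^t* *m absmx (A k)))
       + m%:R * sqfrob (A j) + \sum_k sqfrob (A k) - 2 * r ^+ 2 * sqfrob (A j).
    rewrite sumrB 2!big_split /= -mulr_sumr sumr_const card_ord absmx_herm.
    rewrite -[sqfrob (A j) *+ m]mulr_natl.
    congr (_ - _); rewrite (bigD1 j) //= eqxx big1 ?addr0 // => k.
    by rewrite eq_sym => /negbTE ->.
  rewrite (eq_bigr _ (fun j _ => row_sum j)).
  rewrite sumrB 2!big_split /= -!mulr_sumr -sqfrob_sum sumr_const card_ord.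
  by rewrite rm -[(\sum_i _) *+ m]mulr_natl; ring.
have := ler_sum (index_enum 'I_m) (fun j (_ : true) =>
  ler_sum (index_enum 'I_m) (fun k (_ : true) => pair j k)).
rewrite sumS sumE => h; rewrite -(ler_pM2l t0) -(@ler_pM2l _ 2) //.
by apply: etrans h; congr (_ <= _); ring.
Qed.

(** * The bound by the dimension *)

(** Each l_i contributes the square ((1 + r) l_i - l_i0)^2, except that i = i0
    contributes r^2 l_i0^2, which accounts for all the terms l_i0^2. *)
Lemma peak_sum_le (I : finType) (l : I -> C) (i0 : I) (r : C) :
  (forall i, 0 <= l i) -> (forall i, l i <= l i0) -> 0 <= r ->
  r ^+ 2 = #|I|%:R ->
  2 * (l i0 * \sum_i l i) <= (1 + r) * \sum_i l i ^+ 2.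
Proof.
move=> l0 lmax r0 rI; have t0 : 0 < 1 + r by rewrite ltr_wpDr.
have lR i : l i \is Num.real by exact: ger0_real.
have pt i : 2 * (1 + r) * l i0 * l i <=
  (1 + r) ^+ 2 * l i ^+ 2 + l i0 ^+ 2 - (r ^+ 2 * l i0 ^+ 2) *+ (i == i0).
  have [->|_] := eqVneq i i0.
    by rewrite mulr1n le_eqVlt; apply/orP; left; apply/eqP; ring.
  rewrite subr0 -subr_ge0.
  have -> : (1 + r) ^+ 2 * l i ^+ 2 + l i0 ^+ 2 - 2 * (1 + r) * l i0 * l i
    = ((1 + r) * l i - l i0) ^+ 2 by ring.
  by rewrite real_exprn_even_ge0 // rpredB ?rpredM // gtr0_real.
have := ler_sum (index_enum I) (fun i (_ : true) => pt i).
rewrite -mulr_sumr sumrB big_split /= -mulr_sumr sumr_const cardT -cardE.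
have -> : \sum_i (r ^+ 2 * l i0 ^+ 2) *+ (i == i0) = r ^+ 2 * l i0 ^+ 2.
  by rewrite (bigD1 i0) //= eqxx big1 ?addr0 // => k /negbTE ->.
move=> h; rewrite -(ler_pM2l t0).
apply: le_trans (le_trans h _).
  by rewrite le_eqVlt; apply/orP; left; apply/eqP; ring.
rewrite le_eqVlt; apply/orP; left; apply/eqP; rewrite rI.
by rewrite -[l i0 ^+ 2 *+ _]mulr_natl; ring.
Qed.

(** If X = sum_k K_k S_k then ||X||^2 is the sum of the inner products of K_k and
    X S_k, where sum ||K_k||^2 = tr P and sum ||X S_k||^2 = tr(X^* X P), at most
    the largest eigenvalue times ||X||^2.  The Cauchy-Schwarz inequality is used
    in its quadratic form: ||t K_k - X S_k||^2 >= 0 for t that eigenvalue. *)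
Lemma sqfrob_sum_le_peak m n (A : 'I_m -> 'M[C]_n) (V : 'M[C]_n) (l : 'rV_n) i0 :
  \sum_k absmx (A k) = V ^t* *m diag_mx l *m V -> V *m V ^t* = 1%:M ->
  (forall i, 0 <= l 0 i) -> (forall i, l 0 i <= l 0 i0) ->
  sqfrob (\sum_k A k) <= l 0 i0 * \sum_i l 0 i.
Proof.
move=> EP UV l0 lmax; have UV' := mulmx1C UV.
set X := \sum_k A k; set L := l 0 i0.
have trP : \sum_k \tr (absmx (A k)) = \sum_i l 0 i.
  by rewrite -raddf_sum /= EP -mulmxA mxtrace_mulC -mulmxA UV mulmx1 mxtrace_diag.
have XPX : \sum_k \tr (X ^t* *m X *m absmx (A k)) <= L * sqfrob X.
  rewrite -raddf_sum /= -mulmx_sumr EP !mulmxA mxtrace_mulC !mulmxA.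
  have -> : sqfrob X = sqfrob (X *m V ^t*).
    by rewrite /sqfrob trmxC_mul trmxCK -mulmxA [RHS]mxtrace_mulC -!mulmxA UV' mulmx1.
  have -> : V *m X ^t* *m X *m V ^t* = (X *m V ^t*) ^t* *m (X *m V ^t*).
    by rewrite trmxC_mul trmxCK !mulmxA.
  rewrite mul_mx_diag /mxtrace mulr_sumr; apply: ler_sum => i _.
  by rewrite mxE mulrC ler_wpM2r // trmxC_mul_self_ge0.
have key t : 0 <= t ->
  2 * t * sqfrob X <= t ^+ 2 * (\sum_i l 0 i) + L * sqfrob X.
  move=> t0; have tR : t^* = t by apply/CrealP/ger0_real.
  have term k : t * (\tr ((A k) ^t* *m X) + \tr (X ^t* *m A k)) <=
      t ^+ 2 * \tr (absmx (A k)) + \tr (X ^t* *m X *m absmx (A k)).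
    have [K KK EA] := half_polar (A k).
    have psdA := absmx_psd (A k).
    have [SC _] := sqrtmx_psd psdA; have SS := sqrtmxK psdA.
    move: (sqrtmx (absmx (A k))) SC SS EA => S SC SS EA.
    have := sqfrob_ge0 (t *: K - X *m S); rewrite (sqfrobZB _ _ tR) {1}/sqfrob KK.
    have -> : sqfrob (X *m S) = \tr (X ^t* *m X *m absmx (A k)).
      by rewrite /sqfrob trmxC_mul SC -mulmxA mxtrace_mulC -!mulmxA SS.
    have -> : \tr (K ^t* *m (X *m S)) = \tr ((A k) ^t* *m X).
      by rewrite EA trmxC_mul SC mulmxA mxtrace_mulC mulmxA.
    have -> : \tr ((X *m S) ^t* *m K) = \tr (X ^t* *m A k).
      by rewrite EA trmxC_mul SC -mulmxA mxtrace_mulC mulmxA.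
    by rewrite subr_ge0.
  have := ler_sum (index_enum 'I_m) (fun k (_ : true) => term k).
  rewrite -mulr_sumr !big_split /= -mulr_sumr trP -2!raddf_sum /=.
  rewrite -mulmx_suml -trmxC_sum -mulmx_sumr -/X -/(sqfrob X).
  move=> h; have := le_trans h (lerD (lexx _) XPX).
  by apply: etrans; congr (_ <= _); ring.
(* If P = 0 then any positive t shows that X = 0. *)
have [L0|Lpos] := eqVneq L 0.
  have := key 1 ler01; rewrite L0 !mul0r addr0 big1 => [|i _].
    rewrite mulr0 mulr1 => h; have := sqfrob_ge0 X.
    by rewrite -(pmulr_rle0 _ (ltr0n _ 2)).
  by apply/eqP; rewrite eq_le l0 -L0 lmax.
have {}Lpos : 0 < L by rewrite lt0r Lpos l0.
rewrite -(ler_pM2l Lpos) -(lerD2r (L * sqfrob X)).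
have := key L (ltW Lpos).
by apply: etrans; congr (_ <= _); ring.
Qed.

Lemma sum_le_dim m n (A : 'I_m -> 'M[C]_n) (r : C) : (0 < n)%N ->
  0 <= r -> r ^+ 2 = n%:R ->
  2 * sqfrob (\sum_k A k) <= (1 + r) * sqfrob (\sum_k absmx (A k)).
Proof.
move=> n0 r0 rn; set P := \sum_k absmx (A k).
have psdP : psdmx P.
  split=> [|v].
    by rewrite trmxC_sum; apply: eq_bigr => k _; exact: absmx_herm.
  rewrite mulmx_sumr mulmx_suml summxE sumr_ge0 // => k _.
  by have [_ ->] := absmx_psd (A k).
have [EP l0] := psd_spectral psdP.
have UV := unitarymxP (spectral_unitarymx P).
move: (spectralmx P) (spectral_diag P) EP l0 UV => V l EP l0 UV.
have [i0 _ lmax] := real_arg_maxP (i0 := Ordinal n0) (P := predT)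
  (F := fun i => l 0 i) isT (fun i _ => ger0_real (l0 i)).
have h1 := sqfrob_sum_le_peak EP UV l0 (fun i => lmax i isT).
have rI : r ^+ 2 = #|'I_n|%:R by rewrite card_ord.
have h2 := peak_sum_le l0 (fun i => lmax i isT) r0 rI.
apply: le_trans (le_trans _ h2) _; first by rewrite ler_pM2l.
suff -> : sqfrob P = \sum_i l 0 i ^+ 2 by [].
rewrite /sqfrob (proj1 psdP) EP.
rewrite -!mulmxA mxtrace_mulC !mulmxA -!(mulmxA _ V) UV !mulmx1.
by rewrite mulmx_diag mxtrace_diag; apply: eq_bigr => i _; rewrite mxE expr2.
Qed.

(** * Equality configurations *)

Lemma absmx_outer n p (u v : 'M[C]_(n, p)) :
  u ^t* *m u = v ^t* *m v -> absmx (u *m v ^t*) = v *m v ^t*.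
Proof.
move=> uv; apply/esym/absmxP; split; last first.
  by rewrite trmxC_mul trmxCK !mulmxA -(mulmxA v) -uv !mulmxA.
split=> [|x]; first by rewrite trmxC_mul trmxCK.
have -> : x ^t* *m (v *m v ^t*) *m x = (v ^t* *m x) ^t* *m (v ^t* *m x).
  by rewrite trmxC_mul trmxCK !mulmxA.
exact: trmxC_mul_self_ge0.
Qed.

Lemma sum_lt_cond N d (F : nat -> C) : (d <= N)%N ->
  \sum_(i < N) (i < d)%:R * F i = \sum_(i < d) F i.
Proof.
move=> dN; rewrite (big_ord_widen N F dN) [RHS]big_mkcond; apply: eq_bigr => i _.
by case: (_ < _)%N; rewrite ?mul1r ?mul0r.
Qed.

Lemma sum_delta d (k : nat) (F : nat -> C) : (k < d)%N ->
  \sum_(i < d) (k == i)%:R * F i = F k.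
Proof.
move=> kd; rewrite (bigD1 (Ordinal kd)) //= eqxx mul1r big1 ?addr0 // => i.
by rewrite eq_sym -val_eqE => /negbTE /= ->; rewrite mul0r.
Qed.

Lemma sum_affine d (k : nat) (x y : C) : (k < d)%N ->
  \sum_(i < d) (x * (k == i)%:R + y) = x + d%:R * y.
Proof.
move=> kd; rewrite big_split /= sumr_const card_ord mulr_natl; congr (_ + _).
under eq_bigr do rewrite mulrC.
exact: (sum_delta (fun=> x)).
Qed.

(** The matrices are A_k = v_0 v_k^*, with v_k = a e_k + (1, ..., 1) on the first d
    coordinates for k < d and v_k = 0 beyond.  Taking v_0 as the common left
    factor gives it the norm of the v_k, so that |A_k| = v_k v_k^*.  With
    M = 2 a + d the inner product of two of the v_k, the squared norm a^2 + M
    must be (1 + r) M, that is a^2 = r M, whose positive root is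
    a = r (1 + sqrt (1 + r)). *)
Lemma exists_extremal m n d (r : C) :
  (0 < d)%N -> (d <= m)%N -> (d <= n)%N -> 0 <= r -> r ^+ 2 = d%:R ->
  exists2 A : 'I_m -> 'M[C]_n, 0 < sqfrob (\sum_k absmx (A k)) &
    2 * sqfrob (\sum_k A k) = (1 + r) * sqfrob (\sum_k absmx (A k)).
Proof.
move=> d0 dm dn r0 rd; have t0 : 0 < 1 + r by rewrite ltr_wpDr.
pose s := sqrtC (1 + r); have s0 : 0 <= s by rewrite sqrtC_ge0 ltW.
have sE : s ^+ 2 = 1 + r by rewrite sqrtCK.
pose a := r * (1 + s).
have a0 : 0 <= a by rewrite mulr_ge0 // addr_ge0.
have aE : a ^+ 2 = r * (2 * a + r ^+ 2).
  apply/eqP; rewrite -subr_eq0; apply/eqP.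
  transitivity (r ^+ 2 * (s ^+ 2 - (1 + r))); first by rewrite /a; ring.
  by rewrite sE subrr mulr0.
pose f (k i : nat) : C := (k < d)%:R * ((i < d)%:R * (a * (k == i)%:R + 1)).
have f0 k i : 0 <= f k i by rewrite !mulr_ge0 // addr_ge0 // mulr_ge0.
pose v k : 'cV[C]_n := \col_i f k i.
have vC k : (v k) ^t* = \row_i f k i.
  by apply/rowP=> i; rewrite !mxE; apply/CrealP/ger0_real.
pose N := a ^+ 2 + 2 * a + d%:R.
have vN k : (k < d)%N -> (v k) ^t* *m v k = N%:M.
  move=> kd; apply/matrixP=> i j; rewrite !ord1 mxE mxE eqxx mulr1n vC.
  transitivity (\sum_(i < d) ((a ^+ 2 + 2 * a) * (k == i)%:R + 1)).
    rewrite -(sum_lt_cond (fun i => (a ^+ 2 + 2 * a) * (k == i)%:R + 1) dn).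
    apply: eq_bigr => x _; rewrite !mxE /f kd.
    by case: (x < d)%N; case: (k == x); rewrite ?mul0r ?mulr0 //=; ring.
  by rewrite sum_affine // mulr1.
have v0 k : ~~ (k < d)%N -> v k = 0.
  by move=> /negbTE kd; apply/matrixP=> i j; rewrite !mxE /f kd mul0r.
pose A (k : 'I_m) := v 0%N *m (v k) ^t*.
(* For k >= d this holds because both sides vanish. *)
have absA k : absmx (A k) = v k *m (v k) ^t*.
  have [kd|kd] := boolP (k < d)%N; first by rewrite /A absmx_outer // !vN.
  rewrite /A (v0 k kd) mul0mx trmx0 map_mx0 mulmx0.
  have := @absmx_outer n 1 0 0 erefl; by rewrite mul0mx.
have sumA : sqfrob (\sum_k A k) = N * (d%:R * (a + d%:R) ^+ 2).
  rewrite /A -mulmx_sumr /sqfrob trmxC_mul -trmxC_sum trmxCK.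
  rewrite !mulmxA -(mulmxA _ _ (v 0%N)) vN // mul_mx_scalar -scalemxAl mxtraceZ.
  congr (_ * _); rewrite mxtrace_mulC trace_mx11 mxE.
  transitivity (\sum_(i < d) (a + d%:R) ^+ 2); last first.
    by rewrite sumr_const card_ord mulr_natl.
  rewrite -(sum_lt_cond (fun=> _) dn); apply: eq_bigr => i _.
  have E : (\sum_(k < m) v k) i 0 = (i < d)%:R * (a + d%:R).
    rewrite summxE; under eq_bigr do rewrite mxE.
    rewrite (sum_lt_cond (fun k => (i < d)%:R * (a * (k == i)%:R + 1)) dm).
    rewrite -mulr_sumr.
    have [id|_] := boolP (i < d)%N; last by rewrite !mul0r.
    under eq_bigr do rewrite eq_sym.
    by rewrite sum_affine // mulr1.
  rewrite mxE mxE E; have -> : ((i < d)%:R * (a + d%:R))^* = (i < d)%:R * (a + d%:R).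
    by apply/CrealP/ger0_real; rewrite mulr_ge0 // addr_ge0.
  by case: (i < d)%N; rewrite ?mul0r ?mul1r // expr2.
have sumP : sqfrob (\sum_k absmx (A k)) =
    d%:R * (a ^+ 4 + 2 * a ^+ 2 * (2 * a + d%:R) + d%:R * (2 * a + d%:R) ^+ 2).
  set P := \sum_k _.
  have PE i j : P i j =
    (i < d)%:R * ((j < d)%:R * (a ^+ 2 * (i == j)%:R + (2 * a + d%:R))).
    rewrite summxE.
    transitivity (\sum_(k < m) (k < d)%:R * ((i < d)%:R * ((j < d)%:R *
       ((a * (i == k :> nat)%:R + 1) * (a * (j == k :> nat)%:R + 1))))).
      apply: eq_bigr => k _; rewrite absA vC mxE big_ord1 !mxE /f.
      rewrite (eq_sym (k : nat)) (eq_sym (k : nat) j).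
      by case: (k < d)%N; rewrite ?mul0r // !mul1r; ring.
    rewrite (sum_lt_cond (fun k => (i < d)%:R * ((j < d)%:R *
       ((a * (i == k :> nat)%:R + 1) * (a * (j == k :> nat)%:R + 1)))) dm) -mulr_sumr.
    have [id|_] := boolP (i < d)%N; last by rewrite !mul0r.
    rewrite -mulr_sumr.
    have [jd|_] := boolP (j < d)%N; last by rewrite !mul0r.
    rewrite !mul1r.
    transitivity (\sum_(k < d) ((i == k :> nat)%:R * (a ^+ 2 * (j == k :> nat)%:R + a)
                                + (a * (j == k :> nat)%:R + 1))).
      by apply: eq_bigr => k _; ring.
    rewrite big_split /= (sum_delta (fun k => a ^+ 2 * (j == k :> nat)%:R + a)) //.
    by rewrite sum_affine // (eq_sym (j : nat)); ring.
  have PC : P ^t* = P.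
    apply/matrixP=> i j; rewrite mxE mxE !PE.
    have -> : (j == i) = (i == j) by exact: eq_sym.
    rewrite mulrCA; apply/CrealP/ger0_real; rewrite !mulr_ge0 //.
    by rewrite addr_ge0 ?mulr_ge0 ?exprn_ge0 // addr_ge0 // mulr_ge0.
  rewrite /sqfrob PC.
  set b := (X in _ = _ * X); transitivity (\sum_(i < d) b); last first.
    by rewrite sumr_const card_ord mulr_natl.
  rewrite -(sum_lt_cond (fun=> b) dn); apply: eq_bigr => i _; rewrite mxE.
  have [id|id] := boolP (i < d)%N; last first.
    by rewrite mul0r big1 // => j _; rewrite PE (negbTE id) !mul0r.
  rewrite mul1r.
  pose b1 := a ^+ 4 + 2 * a ^+ 2 * (2 * a + d%:R).
  transitivity (\sum_(j < d) (b1 * (i == j :> nat)%:R + (2 * a + d%:R) ^+ 2));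
    last by rewrite sum_affine.
  rewrite -(sum_lt_cond
    (fun j => b1 * (i == j :> nat)%:R + (2 * a + d%:R) ^+ 2) dn).
  apply: eq_bigr => j _; rewrite !PE id -!val_eqE /= (eq_sym (j : nat)) /b1.
  by case: (j < d)%N; case: (i == j :> nat); rewrite ?mul0r ?mulr0 //=; ring.
exists A.
  have d_gt0 : 0 < d%:R :> C by rewrite ltr0n.
  have b_gt0 : 0 < 2 * a + d%:R by rewrite ltr_wpDl // mulr_ge0.
  rewrite sumP mulr_gt0 // ltr_wpDl //.
    by rewrite addr_ge0 ?exprn_ge0 // (mulr_ge0 _ (ltW b_gt0)) // mulr_ge0 ?exprn_ge0.
  by rewrite mulr_gt0 // exprn_gt0.
rewrite sumA sumP /N -rd.
have -> : (a + r ^+ 2) ^+ 2 = a ^+ 2 + r ^+ 2 * (2 * a + r ^+ 2) by ring.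
have -> : a ^+ 4 = (a ^+ 2) ^+ 2 by ring.
have -> : a ^+ 2 + 2 * a + r ^+ 2 = a ^+ 2 + (2 * a + r ^+ 2) by ring.
rewrite aE; ring.
Qed.

End SquaredNorms.

(** * The real-valued norm and the theorem *)

Lemma frobenius_sq (R : realType) n (X : 'M[R[i]]_n) :
  (frobenius X ^+ 2)%:C%C = sqfrob X.
Proof. by rewrite rmorphXn /= (frobeniusE X).2 sqrtCK. Qed.

Lemma frobenius_ge0 (R : realType) n (X : 'M[R[i]]_n) : 0 <= frobenius X.
Proof. exact: sqrtr_ge0. Qed.

Theorem theorem6p2 (R : realType) (m n : nat) (hm : (1 <= m)%N) (hn : (1 <= n)%N) :
  (forall A : 'I_m -> 'M[R[i]]_n,
     frobenius (\sum_(k < m) A k) <=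
       Num.sqrt ((1 + Num.sqrt (minn m n)%:R) / 2)
         * frobenius (\sum_(k < m) absmx (A k)))
  /\
  (forall c : R,
     (forall A : 'I_m -> 'M[R[i]]_n,
        frobenius (\sum_(k < m) A k)
          <= c * frobenius (\sum_(k < m) absmx (A k))) ->
     Num.sqrt ((1 + Num.sqrt (minn m n)%:R) / 2) <= c).
Proof.
set d := minn m n; set r : R := Num.sqrt d%:R; set kappa := (1 + r) / 2.
have r0 : 0 <= r by exact: sqrtr_ge0.
have rd : r ^+ 2 = d%:R by rewrite sqr_sqrtr.
have kappa0 : 0 <= kappa by rewrite divr_ge0 ?addr_ge0.
have rC0 : 0 <= r%:C%C by rewrite lecR.
have rCd : r%:C%C ^+ 2 = d%:R by rewrite -rmorphXn /= rd rmorph_nat.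
have castl (X : 'M[R[i]]_n) : (2 * frobenius X ^+ 2)%:C%C = 2 * sqfrob X.
  by rewrite -frobenius_sq -[2 in RHS](rmorph_nat (real_complex R)) -rmorphM.
have castr (Y : 'M[R[i]]_n) :
    (2 * (kappa * frobenius Y ^+ 2))%:C%C = (1 + r%:C%C) * sqfrob Y.
  rewrite mulrA /kappa [2 * _]mulrC divfK ?pnatr_eq0 // -frobenius_sq.
  by rewrite -(rmorph1 (real_complex R)) -rmorphD -rmorphM.
split=> [A|c hc].
  have le2 : 2 * sqfrob (\sum_k A k) <=
      (1 + r%:C%C) * sqfrob (\sum_k absmx (A k)).
    move: rCd; rewrite /d; case: (leqP m n) => _ rCd; first exact: sum_le_card.
    exact: sum_le_dim.
  rewrite -(ler_pXn2r (ltn0Sn 1)) ?nnegrE ?mulr_ge0 ?frobenius_ge0 ?sqrtr_ge0 //.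
  rewrite exprMn (sqr_sqrtr kappa0) -(@ler_pM2l _ 2) // -lecR.
  by rewrite castl castr.
have d0 : (0 < d)%N by rewrite /d leq_min hm.
have [A P0 AE] := exists_extremal d0 (geq_minl m n) (geq_minr m n) rC0 rCd.
have P_gt0 : 0 < frobenius (\sum_k absmx (A k)).
  rewrite lt0r frobenius_ge0 andbT; apply: contraTneq P0 => E.
  by rewrite -frobenius_sq E expr0n /= ltxx.
rewrite -(ler_pM2r P_gt0); apply: le_trans (hc A).
rewrite -(ler_pXn2r (ltn0Sn 1)) ?nnegrE ?mulr_ge0 ?frobenius_ge0 ?sqrtr_ge0 //.
rewrite exprMn (sqr_sqrtr kappa0) -(@ler_pM2l _ 2) // -lecR.
by rewrite castl castr AE.
Qed.
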